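(* Let $\Phi$ be a root system with Weyl group $W$, let $T\subseteq\Phi$ be a special closed set, and let $W_T=\{w\in W\mid w(T)=T\}$. Set $S=\{\alpha\in\Phi\setminus(T\cup -T)\mid T\cup\{\alpha,-\alpha\}\text{ is closed}\}$; this is a root subsystem of $\Phi$; let $W^S$ be the subgroup of $W$ generated by the reflections $s_\alpha$ with $\alpha\in S$. Consider the following procedure. (1) Compute a set $\mathcal{P}$ of representatives of the $W^S$-conjugacy classes of symmetric closed subsets $P\subseteq S$ (including the empty one). (2) Form the list of all sets $P\cup T$ with $P\in\mathcal{P}$. (3) Erase $W_T$-conjugate copies from this list, so that exactly one member of each $W_T$-conjugacy class occurring in the list is kept. Then the resulting list consists of closed sets $Q$ with $Q^u=T$, its members are pairwise non-conjugate under $W$, and every closed set $Q\subseteq\Phi$ with $Q^u=T$ is $W$-conjugate to a member of the list.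
   Context: A root system $\Phi$ in a Euclidean space $E$ is a finite set spanning $E$, not containing $0$, such that the only multiples of $\alpha\in\Phi$ in $\Phi$ are $\pm\alpha$, invariant under the reflections $s_\alpha$ ($\alpha\in\Phi$), and with $2(\beta,\alpha)/(\alpha,\alpha)\in\mathbb{Z}$ for $\alpha,\beta\in\Phi$. Its Weyl group $W$ is generated by the $s_\alpha$, $\alpha\in\Phi$. A subset $T\subseteq\Phi$ is closed if for all $\alpha,\beta\in T$, $\alpha+\beta\in\Phi$ implies $\alpha+\beta\in T$. For a closed set $Q$, its symmetric part is $Q^r=\{\alpha\in Q\mid -\alpha\in Q\}$ and its special part is $Q^u=\{\alpha\in Q\mid -\alpha\notin Q\}$. A closed set $Q$ is symmetric if $Q=Q^r$ and special if $Q=Q^u$. Two subsets are conjugate under a subgroup $H\le W$ if some $w\in H$ maps one onto the other. A root subsystem is meant as a subset that is a root system in its span (possibly empty). *)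

(* Defs.v *)
From HB Require Import structures.
From mathcomp Require Import all_boot all_order all_algebra.
From mathcomp Require Import finmap.
From mathcomp Require Import reals.

Set Implicit Arguments.
Unset Strict Implicit.
Unset Printing Implicit Defensive.

Import Order.TTheory GRing.Theory Num.Theory.

Local Open Scope fset_scope.
Local Open Scope ring_scope.

(* A Euclidean space is a finite-dimensional real vector space
   E : vectType R together with an inner product dot : {dot E for idfun},
   i.e., a positive definite symmetric bilinear form. *)

Section Reflections.
Context {R : realType} {E : vectType R} (dot : {dot E for idfun}).

Definition refl_fun (a x : E) : E := x - (2 * dot x a / dot a a) *: a.

Fact refl_fun_is_linear a : linear (refl_fun a).
Proof.
move=> k x y; rewrite /refl_fun.
have -> : dot (k *: x + y) a = k * dot x a + dot y a by rewrite linearPl.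
rewrite mulrDr mulrDl scalerDl opprD scalerBr scalerA addrACA.
by rewrite mulrCA !mulrA.
Qed.

HB.instance Definition _ a :=
  GRing.isLinear.Build R E E *:%R (refl_fun a) (refl_fun_is_linear a).

Definition refl (a : E) : 'End(E) := linfun (refl_fun a).

Lemma reflE a x : refl a x = x - (2 * dot x a / dot a a) *: a.
Proof. by rewrite lfunE. Qed.

End Reflections.

Section Groups.
Context {R : realType} {E : vectType R}.

(* The subgroup of GL(E) generated by a set G of invertible endomorphisms;
   for invertible f, f^-1%VF is the two-sided inverse of f. *)
Inductive generated (G : 'End(E) -> Prop) : 'End(E) -> Prop :=
| generated_in f : G f -> generated G f
| generated_1 : generated G \1%VF
| generated_M f g : generated G f -> generated G g -> generated G (f \o g)%VF
| generated_V f : generated G f -> generated G (f^-1)%VF.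

Definition conjugate (H : 'End(E) -> Prop) (A B : {fset E}) : Prop :=
  exists2 w : 'End(E), H w & w @` A = B.

Definition stabilizer (H : 'End(E) -> Prop) (A : {fset E}) (w : 'End(E)) :
  Prop := H w /\ w @` A = A.

(* L is a set of representatives of the classes, under conjugacy by H, of the
   sets satisfying X. *)
Definition representatives (X : {fset E} -> Prop) (H : 'End(E) -> Prop)
    (L : {fset {fset E}}) : Prop :=
  (forall A, A \in L -> X A) /\
  (forall A, X A -> exists! B, B \in L /\ conjugate H A B).

End Groups.

Section RootSystems.
Context {R : realType} {E : vectType R} (dot : {dot E for idfun}).
Implicit Types Phi S T P Q : {fset E}.

(* Phi is a root system in the Euclidean space V, a subspace of E. *)
Record root_system_in (V : {vspace E}) Phi : Prop := RootSystemIn {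
  root_span : <<Phi>>%VS = V;
  root_neq0 : 0 \notin Phi;
  root_multiples : forall a, a \in Phi ->
    forall c : R, c *: a \in Phi <-> c = 1 \/ c = -1;
  root_refl : forall a, a \in Phi -> refl dot a @` Phi = Phi;
  root_int : forall a b, a \in Phi -> b \in Phi ->
    2 * dot b a / dot a a \is a Num.int
}.

Definition root_system Phi : Prop := root_system_in fullv Phi.

Definition root_subsystem Phi S : Prop :=
  S `<=` Phi /\ root_system_in <<S>>%VS S.

Definition reflection_group Phi : 'End(E) -> Prop :=
  generated (fun s => exists2 a, a \in Phi & s = refl dot a).

Definition oppset T : {fset E} := [fset - a | a in T].

Definition closed_in Phi T : bool :=
  (T `<=` Phi) &&
  [forall a : T, forall b : T, (val a + val b \in Phi) ==> (val a + val b \in T)].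

Definition sym_part Q : {fset E} := [fset a in Q | - a \in Q].
Definition special_part Q : {fset E} := [fset a in Q | - a \notin Q].

Definition symmetric_closed Phi Q : Prop := closed_in Phi Q /\ sym_part Q = Q.
Definition special_closed Phi Q : Prop := closed_in Phi Q /\ special_part Q = Q.

Definition subsystem_of Phi T : {fset E} :=
  [fset a in Phi `\` (T `|` oppset T) | closed_in Phi (T `|` [fset a; - a])].

End RootSystems.

(* Main.v *)
Require Import Defs.
From HB Require Import structures.
From mathcomp Require Import all_boot all_order all_algebra.
From mathcomp Require Import finmap.
From mathcomp Require Import reals.
From mathcomp Require Import zify ring lra.

Set Implicit Arguments.
Unset Strict Implicit.
Unset Printing Implicit Defensive.

Import Order.TTheory GRing.Theory Num.Theory.

Local Open Scope fset_scope.
Local Open Scope ring_scope.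

(** The heart of the matter is that every reflection s_a with a in S maps T
    onto itself.  Write s_a t = t - n a for t in T, with n nonnegative after
    replacing a by -a if necessary.  The vectors t, t - a, ..., t - n a are
    roots, by integrality and the Cauchy-Schwarz inequality, and each follows
    from the one before by adding -a; as T together with a and -a is closed,
    none of them leaves T ([root_sub], [closed_string], [refl_closed_mem]).
    Hence s_a preserves all the data that define S, so S is a root subsystem
    ([subsystem_root_subsystem]), and every element of the group W^S maps T
    onto itself ([subsystem_Weyl_stable]).

    The closed sets with special part T are exactly the unions of T with a
    symmetric closed subset of S, the subset being the symmetric part
    ([closedU], [sym_part_subsystem]).  Given such a Q, an element of W^S moves
    its symmetric part to a representative P and leaves T in place, so it
    carries Q to the union of P and T; an element of W_T then carries that
    union to a member of the final list.  Conversely, taking special parts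
    commutes with injective linear maps ([special_part_image]), so an element
    of W that carries one set with special part T to another lies in W_T:
    W-conjugacy of such sets is W_T-conjugacy, which the last step of the
    procedure has removed. *)

(** * Images of finite sets under linear maps *)

Section Images.
Context {R : realType} {E : vectType R}.
Implicit Types (f g : 'End(E)) (Phi T Q : {fset E}).

Lemma mem_stable f T x :
  injective f -> f @` T = T -> (f x \in T) = (x \in T).
Proof. by move=> f_inj fT; rewrite -{1}fT mem_imfset. Qed.

Lemma image_comp f g T : (f \o g)%VF @` T = f @` (g @` T).
Proof.
rewrite -imfset_comp; apply/fsetP=> y.
by apply/imfsetP/imfsetP=> -[x xT ->]; exists x; rewrite //= ?comp_lfunE.
Qed.

Lemma image_id T : \1%VF @` T = T.
Proof.
apply/fsetP=> y; apply/imfsetP/idP=> [[x xT ->]|yT]; first by rewrite id_lfunE.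
by exists y; rewrite ?id_lfunE.
Qed.

Lemma image_inv f T : injective f -> f @` T = T -> f^-1%VF @` T = T.
Proof.
move=> /lker0P f_ker fT; have : (f^-1 \o f)%VF @` T = T.
  by rewrite lker0_compVf // image_id.
by rewrite image_comp fT.
Qed.

Lemma closed_inP Phi T :
  reflect (T `<=` Phi /\
           forall a b, a \in T -> b \in T -> a + b \in Phi -> a + b \in T)
          (closed_in Phi T).
Proof.
apply: (iffP andP) => -[sT clT]; split=> //.
  move=> a b aT bT abPhi.
  have /forallP/(_ [` aT])/forallP/(_ [` bT])/implyP := clT; exact.
apply/forallP=> a; apply/forallP=> b; apply/implyP=> abPhi.
by apply: clT => //; apply: valP.
Qed.

Lemma closed_image f Phi T :
  injective f -> f @` Phi = Phi -> closed_in Phi T -> closed_in Phi (f @` T).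
Proof.
move=> f_inj fPhi /closed_inP[/fsubsetP sT clT]; apply/closed_inP; split.
  by apply/fsubsetP=> _ /imfsetP[x /= xT ->]; rewrite mem_stable // sT.
move=> _ _ /imfsetP[x /= xT ->] /imfsetP[y /= yT ->].
by rewrite -linearD mem_stable // mem_imfset //; apply: clT.
Qed.

Lemma special_part_image f Q :
  injective f -> special_part (f @` Q) = f @` special_part Q.
Proof.
move=> f_inj; apply/fsetP=> y; rewrite !inE /=.
apply/andP/imfsetP=> [[/imfsetP[x /= xQ ->]]|[x]].
  by rewrite -linearN mem_imfset // => NxQ; exists x; rewrite // !inE xQ.
by rewrite !inE /= => /andP[xQ NxQ] ->; rewrite -linearN !mem_imfset.
Qed.

Lemma mem_oppset T x : (x \in oppset T) = (- x \in T).
Proof.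
apply/imfsetP/idP=> [[y /= yT ->]|NxT]; first by rewrite opprK.
by exists (- x); rewrite ?opprK.
Qed.

Lemma image_pair f a : f @` [fset a; - a] = [fset f a; - f a].
Proof. by rewrite imfsetU !imfset_fset1 linearN. Qed.

(** * Generated groups *)

Lemma generated_sub (G H : 'End(E) -> Prop) :
  (forall f, G f -> H f) -> forall f, generated G f -> generated H f.
Proof.
move=> sGH f; elim=> {f} [f Gf||f g _ Hf _ Hg|f _ Hf].
- exact/generated_in/sGH.
- exact: generated_1.
- exact: generated_M.
- exact: generated_V.
Qed.

Lemma generated_inj (G : 'End(E) -> Prop) :
  (forall f, G f -> injective f) -> forall f, generated G f -> injective f.
Proof.
move=> Ginj f; elim=> {f} [//||f g _ f_inj _ g_inj|f _ f_inj] x y.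
- by rewrite !id_lfunE.
- by rewrite !comp_lfunE => /f_inj/g_inj.
- move=> e; have fK := lker0_lfunVK (introT lker0P f_inj).
  by rewrite -(fK x) e fK.
Qed.

Lemma generated_stable (G : 'End(E) -> Prop) T :
    (forall f, G f -> injective f /\ f @` T = T) ->
  forall f, generated G f -> f @` T = T.
Proof.
move=> GT f Gf; have Ginj g : G g -> injective g by case/GT.
elim: Gf => {f} [f /GT[]//||f g _ fT _ gT|f Gf fT].
- exact: image_id.
- by rewrite image_comp gT fT.
- exact: image_inv (generated_inj Ginj Gf) fT.
Qed.

End Images.

(** * Reflections and root strings *)

Section Roots.
Context {R : realType} {E : vectType R} (dot : {dot E for idfun}).
Implicit Types (a b t x : E) (Phi T P Q : {fset E}).

Lemma dotC a b : dot a b = dot b a.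
Proof. by rewrite hermC expr0 mul1r. Qed.

Lemma dotBZl k a b x : dot (a - k *: b) x = dot a x - k * dot b x.
Proof. by rewrite linearBl linearZl_LR. Qed.

Definition cartan a x : R := 2 * dot x a / dot a a.

Lemma refl_cartan a x : refl dot a x = x - cartan a x *: a.
Proof. exact: reflE. Qed.

Lemma cartanNl a x : cartan (- a) x = - cartan a x.
Proof. by rewrite /cartan linearNl !linearNr /= !opprK mulrN mulNr. Qed.

Lemma reflK a : involutive (refl dot a).
Proof.
move=> x; rewrite !refl_cartan /cartan; have [->|a0] := eqVneq a 0.
  by rewrite !scaler0 !subr0.
have aa0 : dot a a != 0 by rewrite gt_eqF // neq0_dnorm_gt0.
rewrite -addrA -opprD -scalerDl dotBZl.
set c := (X in X *: a); have -> : c = 0 by rewrite /c; field.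
by rewrite scale0r subr0.
Qed.

Lemma refl_inj a : injective (refl dot a).
Proof. exact: inv_inj (reflK a). Qed.

Lemma reflN a : refl dot (- a) =1 refl dot a.
Proof. by move=> x; rewrite !refl_cartan cartanNl scaleNr scalerN opprK. Qed.

Lemma refl_stable a T :
  (forall x, x \in T -> refl dot a x \in T) -> refl dot a @` T = T.
Proof.
move=> aT; apply/fsetP=> y; apply/imfsetP/idP=> [[x /= xT ->]|yT].
  exact: aT.
by exists (refl dot a y); rewrite ?reflK //=; apply: aT.
Qed.

Variable Phi : {fset E}.
Hypothesis hPhi : root_system dot Phi.

Lemma rootN a : a \in Phi -> - a \in Phi.
Proof. by move=> aPhi; rewrite -scaleN1r (root_multiples hPhi aPhi); right. Qed.

Lemma root_nz a : a \in Phi -> a != 0.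
Proof. by apply: contraTneq => ->; apply: root_neq0 hPhi. Qed.

Lemma refl_root a b : a \in Phi -> b \in Phi -> refl dot a b \in Phi.
Proof.
move=> aPhi bPhi; rewrite mem_stable //; first exact: refl_inj.
exact: (root_refl hPhi aPhi).
Qed.

Lemma root_double a : a \in Phi -> a + a \notin Phi.
Proof.
move=> aPhi; apply/negP; rewrite -mulr2n -scaler_nat.
by rewrite (root_multiples hPhi aPhi) => -[]; lra.
Qed.

(** Cauchy-Schwarz, strict because a and b are not proportional, bounds the
    product of the two Cartan integers below 4.  Both are positive, so one of
    them is 1, and the corresponding reflection yields b - a or its
    opposite. *)
Lemma root_sub a b :
  a \in Phi -> b \in Phi -> a != b -> 0 < cartan a b -> b - a \in Phi.
Proof.
move=> aPhi bPhi aDb ab_gt0.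
have aa_gt0 : 0 < dot a a by rewrite neq0_dnorm_gt0 ?root_nz.
have bb_gt0 : 0 < dot b b by rewrite neq0_dnorm_gt0 ?root_nz.
have d_gt0 : 0 < dot b a.
  by move: ab_gt0; rewrite /cartan pmulr_lgt0 ?invr_gt0 // pmulr_rgt0 // ltr0n.
have strict : dot b a ^+ 2 < dot a a * dot b b.
  (* The vector b - c a is the component of b orthogonal to a. *)
  pose c := dot b a / dot a a.
  have cE : c * dot a a = dot b a by rewrite divfK // gt_eqF.
  have c_gt0 : 0 < c by rewrite divr_gt0.
  have bDca : b - c *: a != 0.
    rewrite subr_eq0; apply/eqP=> bE.
    have : c *: a \in Phi by rewrite -bE.
    rewrite (root_multiples hPhi aPhi) => -[c1|cN1]; last lra.
    by rewrite bE c1 scale1r eqxx in aDb.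
  have := neq0_dnorm_gt0 (s := dot) _ bDca.
  rewrite dotBZl (dotC b) (dotC a) !dotBZl (dotC a b).
  by nra.
have /intrP[m mE] := root_int hPhi aPhi bPhi.
have /intrP[n nE] := root_int hPhi bPhi aPhi.
have mE' : m%:~R * dot a a = 2 * dot b a by rewrite -mE divfK // gt_eqF.
have nE' : n%:~R * dot b b = 2 * dot b a by rewrite -nE divfK ?gt_eqF // dotC.
have m_gt0 : 0 < m by rewrite -(ltr0z R) -mE.
have n_gt0 : 0 < n by rewrite -(ltr0z R) -nE dotC divr_gt0 // mulr_gt0.
have mn4 : m * n < 4.
  rewrite -(ltr_int R) rmorphM /=.
  rewrite -(ltr_pM2r (mulr_gt0 aa_gt0 bb_gt0)) mulrACA mE' nE'.
  by lra.
have [m1|n1] : m = 1 \/ n = 1 by nia.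
  by have := refl_root aPhi bPhi; rewrite refl_cartan /cartan mE m1 scale1r.
have := refl_root bPhi aPhi; rewrite refl_cartan /cartan nE n1 scale1r => /rootN.
by rewrite opprB.
Qed.

Variable T : {fset E}.
Hypothesis T_closed : closed_in Phi T.

(** Passing from t to t - a lowers the Cartan integer by 2, so the induction
    on n goes two steps down; it reaches t - (n - 1) a, and the last step uses
    that t - n a is the root s_a t. *)
Lemma closed_string n a t :
    a \in Phi -> a \notin T ->
    closed_in Phi (T `|` [fset a; - a]) ->
  t \in T -> cartan a t = n%:R -> t - n%:R *: a \in T.
Proof.
move=> aPhi aT /closed_inP[_ cl].
have /closed_inP[/fsubsetP sT _] := T_closed.
(* The sum u - a stays in the union of T, a and -a.  If it were a, then u
   would be 2a; if it were -a, then u would be 0; neither is a root. *)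
have step u : u \in T -> u - a \in Phi -> u - a \in T.
  move=> uT uaPhi; have := cl u (- a).
  rewrite !inE uT eqxx !orbT /= => /(_ isT isT uaPhi) /or3P[//|/eqP e|/eqP e].
    have /negP[] := root_double aPhi; suff -> : a + a = u by apply: sT.
    by rewrite -{1}e subrK.
  by have /eqP := root_nz (sT _ uT); rewrite -[u](subrK a) e addNr.
have [k] := ubnP n; elim: k n t => // k IH [|n] t ltnk tT tE.
  by rewrite scale0r subr0.
have sPhi : t - n.+1%:R *: a \in Phi.
  by rewrite -tE -refl_cartan; apply/refl_root/sT.
rewrite mulrSr scalerDl scale1r opprD addrA in sPhi *.
apply: (step _ _ sPhi) => {sPhi}.
case: n ltnk tE => [|n] ltnk tE; first by rewrite scale0r subr0.
have taT : t - a \in T.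
  apply: (step _ tT); apply: (root_sub aPhi (sT _ tT)).
    by apply: contraNN aT => /eqP->.
  by rewrite tE ltr0n.
have aa0 : dot a a != 0 by rewrite gt_eqF // neq0_dnorm_gt0 // root_nz.
have := IH n (t - a) _ taT; rewrite mulrSr scalerDl scale1r opprD.
rewrite addrCA addrC; apply; first exact: ltnW.
rewrite /cartan -[a in t - a]scale1r dotBZl mul1r mulrBr mulrBl mulfK //.
by rewrite -/(cartan a t) tE -addn2 natrD addrK.
Qed.

(** The hypotheses are symmetric in a and -a, which define the same
    reflection, so the Cartan integer may be taken nonnegative. *)
Lemma refl_closed_mem a t :
    a \in Phi -> a \notin T -> - a \notin T ->
    closed_in Phi (T `|` [fset a; - a]) ->
  t \in T -> refl dot a t \in T.
Proof.
move=> aPhi aT NaT cl tT.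
have /closed_inP[/fsubsetP sT _] := T_closed.
have /intrP[[n|n] tE] := root_int hPhi aPhi (sT _ tT).
  by rewrite refl_cartan /cartan tE -pmulrn; apply: closed_string.
have NtE : cartan (- a) t = n.+1%:R.
  by rewrite cartanNl /cartan tE NegzE mulrNz opprK.
rewrite -reflN refl_cartan NtE; apply: closed_string => //.
- exact: rootN.
- by rewrite opprK [X in _ `|` X]fsetUC.
Qed.

(** * The subsystem attached to a closed set *)

Local Notation S := (subsystem_of Phi T).

Lemma subsystemP a :
  reflect [/\ a \in Phi, a \notin T, - a \notin T &
            closed_in Phi (T `|` [fset a; - a])] (a \in S).
Proof.
rewrite !inE /= mem_oppset negb_or -!andbA.
apply: (iffP and4P) => [[]|[]]; by split.
Qed.

Lemma subsystem_sub : S `<=` Phi.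
Proof. by apply/fsubsetP=> a /subsystemP[]. Qed.

Lemma subsystemN a : a \in S -> - a \in S.
Proof.
move=> /subsystemP[aPhi aT NaT cl]; apply/subsystemP.
split; rewrite ?opprK //; first exact: rootN.
by rewrite [X in _ `|` X]fsetUC.
Qed.

Lemma refl_subsystem_closed a : a \in S -> refl dot a @` T = T.
Proof.
by move=> /subsystemP[*]; apply: refl_stable => t; apply: refl_closed_mem.
Qed.

(** The reflection preserves Phi and T, hence every condition defining S. *)
Lemma refl_subsystem a : a \in S -> refl dot a @` S = S.
Proof.
move=> aS; apply: refl_stable => b /subsystemP[bPhi bT NbT cl].
have aPhi := fsubsetP subsystem_sub a aS.
have aT := refl_subsystem_closed aS; have a_inj := @refl_inj a.
have aPhiE := root_refl hPhi aPhi.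
apply/subsystemP; rewrite -linearN !mem_stable //; split=> //.
rewrite linearN -image_pair -{1}aT -imfsetU.
exact: (closed_image a_inj aPhiE).
Qed.

Lemma subsystem_root_subsystem : root_subsystem dot Phi S.
Proof.
have sS := fsubsetP subsystem_sub; split; first exact: subsystem_sub.
split=> //.
- by apply: contra (root_neq0 hPhi); apply: sS.
- move=> a aS c; split=> [/sS|[]->].
  + by move/(root_multiples hPhi (sS _ aS)).
  + by rewrite scale1r.
  + by rewrite scaleN1r subsystemN.
- exact: refl_subsystem.
- by move=> a b /sS aPhi /sS bPhi; apply: (root_int hPhi).
Qed.

Lemma Weyl_inj A w : reflection_group dot A w -> injective w.
Proof. by apply: generated_inj => _ [a _ ->]; apply: refl_inj. Qed.

Lemma subsystem_Weyl_stable w : reflection_group dot S w -> w @` T = T.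
Proof.
apply: generated_stable => _ [a aS ->]; split; first exact: refl_inj.
exact: refl_subsystem_closed.
Qed.

Lemma subsystem_Weyl_sub w :
  reflection_group dot S w -> reflection_group dot Phi w.
Proof.
apply: generated_sub => _ [a aS ->]; exists a => //.
exact: (fsubsetP subsystem_sub).
Qed.

(** * Closed sets with a given special part *)

Hypothesis T_special : special_part T = T.

Lemma special_opp t : t \in T -> - t \notin T.
Proof. by rewrite -{1}T_special !inE => /andP[]. Qed.

(** A mixed sum p + t remains in the union of T, p and -p by the definition of
    S; it is neither p nor -p, as t would be 0 or -2p, hence it lies in T. *)
Lemma closedU P : P `<=` S -> symmetric_closed Phi P ->
  closed_in Phi (P `|` T) /\ special_part (P `|` T) = T.
Proof.
move=> /fsubsetP sP [/closed_inP[_ clP] symP].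
have PN p : p \in P -> - p \in P by rewrite -{1}symP !inE => /andP[].
have /closed_inP[/fsubsetP sT clT] := T_closed.
have PT p t : p \in P -> t \in T -> p + t \in Phi -> p + t \in T.
  move=> /sP/subsystemP[pPhi pT NpT /closed_inP[_ cl]] tT ptPhi.
  have := cl p t; rewrite !inE eqxx tT !orbT /= => /(_ isT isT ptPhi).
  case/or3P=> // /eqP e.
    have /eqP[] := root_nz (sT _ tT); apply: (addrI p).
    by rewrite e addr0.
  have /negP[] := root_double pPhi; rewrite -[p + p]opprK rootN //.
  rewrite opprD; suff -> : - p - p = t by apply: sT.
  by rewrite -{1}e addrC addKr.
split.
  apply/closed_inP; split.
    by apply/fsubsetP=> x; rewrite inE => /orP[/sP/subsystemP[]|/sT].
  move=> a b; rewrite !inE => /orP[aP|aT] /orP[bP|bT] abPhi; apply/orP.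
  - by left; apply: clP.
  - by right; apply: PT.
  - by right; rewrite addrC; apply: PT; rewrite // addrC.
  - by right; apply: clT.
apply/fsetP=> x; rewrite !inE /= negb_or; apply/and3P/idP.
  by case=> /orP[/PN->|].
move=> xT; split; rewrite ?xT ?orbT ?special_opp //.
by apply: contraL xT => /sP/subsystemP[_ _]; rewrite opprK.
Qed.

(** Adding c from the symmetric part to t in T stays in Q; if -(c + t) were
    also in Q, then so would be -t = -(c + t) + c, although t is in the special
    part.  So T absorbs such sums, which puts the symmetric part inside S. *)
Lemma sym_part_subsystem Q : closed_in Phi Q -> special_part Q = T ->
  sym_part Q `<=` S /\ symmetric_closed Phi (sym_part Q).
Proof.
move=> /closed_inP[/fsubsetP sQ clQ] QT.
have memT x : (x \in T) = (x \in Q) && (- x \notin Q) by rewrite -QT !inE.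
have /closed_inP[/fsubsetP sT clT] := T_closed.
split.
  apply/fsubsetP=> a aQ; apply/subsystemP.
  have {aQ}/andP[aQ NaQ] : (a \in Q) && (- a \in Q) by move: aQ; rewrite !inE.
  have aPhi := sQ a aQ; have NaPhi := sQ _ NaQ.
  split; rewrite ?memT ?aQ ?NaQ ?opprK ?aQ //=.
  have addT c t :
    c \in Q -> - c \in Q -> t \in T -> c + t \in Phi -> c + t \in T.
    rewrite !memT => cQ NcQ /andP[tQ NtQ] ctPhi; rewrite clQ //=.
    apply: contra NtQ => NctQ.
    have -> : - t = - (c + t) + c by rewrite opprD addrC addNKr.
    apply: clQ => //; rewrite opprD addrC addNKr.
    by apply: rootN; apply: sQ.
  have Nsum0 : 0 \notin Phi := root_neq0 hPhi.
  apply/closed_inP; split.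
    apply/fsubsetP=> x; rewrite !inE => /or3P[/sT //||] /eqP-> //.
  have pairQ c : (c == a) || (c == - a) -> c \in Q /\ - c \in Q.
    by case/orP=> /eqP->; rewrite ?opprK.
  move=> x y; rewrite !inE => /orP[xT|xa] /orP[yT|ya] xyPhi.
  - by rewrite clT.
  - by have [yQ NyQ] := pairQ y ya; rewrite addrC addT // addrC.
  - by have [xQ NxQ] := pairQ x xa; rewrite addT.
  - case/orP: xa xyPhi => /eqP->; case/orP: ya => /eqP->;
      rewrite ?subrr ?addNr ?(negPf Nsum0) //;
      by rewrite (negPf (root_double _)).
split; last first.
  by apply/fsetP=> x; rewrite !inE /= opprK; case: (x \in Q); case: (- x \in Q).
apply/closed_inP; split.
  by apply/fsubsetP=> x; rewrite !inE => /andP[/sQ].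
move=> x y; rewrite !inE => /andP[xQ NxQ] /andP[yQ NyQ] xyPhi.
by rewrite clQ //= opprD clQ // -opprD rootN.
Qed.

End Roots.

Lemma sym_special_part (R : realType) (E : vectType R) (Q : {fset E}) :
  sym_part Q `|` special_part Q = Q.
Proof. by apply/fsetP=> x; rewrite !inE /= -andb_orr orbN andbT. Qed.

(** * The theorem *)

Theorem mainTheorem2 (R : realType) (E : vectType R) (dot : {dot E for idfun})
    (Phi T : {fset E}) (hPhi : root_system dot Phi)
    (hT : special_closed Phi T) :
  let W := reflection_group dot Phi in
  let WT := stabilizer W T in
  let S := subsystem_of Phi T in
  let WS := reflection_group dot S in
  root_subsystem dot Phi S /\
  forall PP L : {fset {fset E}},
    representatives (fun P => P `<=` S /\ symmetric_closed Phi P) WS PP ->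
    representatives (fun Q => Q \in [fset P `|` T | P in PP]) WT L ->
    [/\ forall Q, Q \in L -> closed_in Phi Q /\ special_part Q = T,
        forall Q1 Q2, Q1 \in L -> Q2 \in L -> Q1 <> Q2 -> ~ conjugate W Q1 Q2
      & forall Q, closed_in Phi Q -> special_part Q = T ->
          exists2 Q', Q' \in L & conjugate W Q Q'].
Proof.
case: hT => T_closed T_special W WT S WS.
split; first exact: subsystem_root_subsystem.
move=> PP L [PP_sym PP_rep] [L_list L_rep].
have L_closed Q : Q \in L -> closed_in Phi Q /\ special_part Q = T.
  by move=> /L_list/imfsetP[P /= /PP_sym[sP clP] ->]; apply: (closedU hPhi).
split=> //.
- move=> Q1 Q2 Q1L Q2L Q12 [w Ww wQ].
  (* T is recovered from Q1 and Q2 as their special part, so w maps it onto itself. *)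
  have wT : w @` T = T.
    have [[_ Q1T] [_ Q2T]] := (L_closed _ Q1L, L_closed _ Q2L).
    by rewrite -[RHS]Q2T -wQ special_part_image ?Q1T //; apply: Weyl_inj Ww.
  have [Q [_ uniqQ]] := L_rep Q1 (L_list _ Q1L).
  (* Q1 and Q2 both represent the class of Q1. *)
  apply: Q12; rewrite -(uniqQ Q1); last first.
    by split=> //; exists \1%VF; rewrite ?image_id //; split;
      [apply: generated_1 | apply: image_id].
  by apply: uniqQ; split=> //; exists w.
move=> Q clQ QT.
have [sP symP] := sym_part_subsystem hPhi T_closed clQ QT.
have [P [[PPP [w1 WSw1 w1P]] _]] := PP_rep (sym_part Q) (conj sP symP).
have w1Q : w1 @` Q = P `|` T.
  rewrite -[Q]sym_special_part imfsetU w1P QT.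
  by rewrite (subsystem_Weyl_stable hPhi T_closed WSw1).
have PT_list : P `|` T \in [fset P `|` T | P in PP].
  by apply/imfsetP; exists P.
have [Q' [[Q'L [w2 [Ww2 _] w2Q]] _]] := L_rep _ PT_list.
exists Q' => //; exists (w2 \o w1)%VF; last by rewrite image_comp w1Q.
by apply: generated_M => //; apply: subsystem_Weyl_sub WSw1.
Qed.
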